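(* Let $(\bm{x},\bm{u}) \in \mathbb{R}^{n_x}\times\mathbb{R}^{n_u}$ be (part of) an interior-point iterate at which the Jacobian $G_x$ is invertible. Define the reduced Hessian and the reduced Jacobian by $$\hat{W}_{uu} = W_{uu} - W_{ux} G_x^{-1} G_u - G_u^\top G_x^{-\top} W_{xu} + G_u^\top G_x^{-\top} (W_{xx} + \Sigma_x) G_x^{-1} G_u, \qquad \hat{A}_u = A_u - A_x G_x^{-1} G_u .$$ Then the augmented KKT system $$\begin{bmatrix} W_{uu}+\Sigma_u & W_{ux} & 0 & G_u^\top & A_u^\top \\ W_{xu} & W_{xx}+\Sigma_x & 0 & G_x^\top & A_x^\top \\ 0 & 0 & \Sigma_s & 0 & -I \\ G_u & G_x & 0 & 0 & 0 \\ A_u & A_x & -I & 0 & 0 \end{bmatrix} \begin{bmatrix} \bm{p}_u \\ \bm{p}_x \\ \bm{p}_s \\ \bm{p}_\lambda \\ \bm{p}_y \end{bmatrix} = - \begin{bmatrix} \bm{r}_1 \\ \bm{r}_2 \\ \bm{r}_3 \\ \bm{r}_4 \\ \bm{r}_5 \end{bmatrix}$$ is equivalent to the reduced system $$\begin{bmatrix} \hat{W}_{uu}+\Sigma_u & 0 & \hat{A}_u^\top \\ 0 & \Sigma_s & -I \\ \hat{A}_u & -I & 0 \end{bmatrix} \begin{bmatrix} \bm{p}_u \\ \bm{p}_s \\ \bm{p}_y \end{bmatrix} = - \begin{bmatrix} \hat{\bm{r}}_1 \\ \hat{\bm{r}}_2 \\ \hat{\bm{r}}_3 \end{bmatrix},$$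 where $$\hat{\bm{r}}_1 = \bm{r}_1 - G_u^\top G_x^{-\top} \bm{r}_2 - \big(W_{ux} - G_u^\top G_x^{-\top}(W_{xx}+\Sigma_x)\big) G_x^{-1} \bm{r}_4, \quad \hat{\bm{r}}_2 = \bm{r}_3, \quad \hat{\bm{r}}_3 = \bm{r}_5 - A_x G_x^{-1} \bm{r}_4,$$ with the state and adjoint descent directions recovered as $$\bm{p}_x = -G_x^{-1}\big(\bm{r}_4 + G_u \bm{p}_u\big), \qquad \bm{p}_\lambda = -G_x^{-\top}\Big(\bm{r}_2 + A_x^\top \bm{p}_y + W_{xu}\bm{p}_u + (W_{xx}+\Sigma_x)\bm{p}_x\Big).$$ That is, $(\bm{p}_u,\bm{p}_x,\bm{p}_s,\bm{p}_\lambda,\bm{p}_y)$ solves the augmented system if and only if $(\bm{p}_u,\bm{p}_s,\bm{p}_y)$ solves the reduced system and $\bm{p}_x$, $\bm{p}_\lambda$ are given by these two formulas.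
   Context: Consider $\min_{\bm{x},\bm{u},\bm{s}} f(\bm{x},\bm{u})$ subject to $\bm{u}\ge 0$, $\bm{x}\ge 0$, $\bm{s}\ge 0$, $g(\bm{x},\bm{u})=0$, $h(\bm{x},\bm{u})+\bm{s}=0$, with state $\bm{x}\in\mathbb{R}^{n_x}$, control $\bm{u}\in\mathbb{R}^{n_u}$, slack $\bm{s}\in\mathbb{R}^m$, and twice continuously differentiable functions $f:\mathbb{R}^{n_x}\times\mathbb{R}^{n_u}\to\mathbb{R}$, $g:\mathbb{R}^{n_x}\times\mathbb{R}^{n_u}\to\mathbb{R}^{n_x}$, $h:\mathbb{R}^{n_x}\times\mathbb{R}^{n_u}\to\mathbb{R}^m$. The Lagrangian is $$L = f(\bm{x},\bm{u}) + \bm{\lambda}^\top g(\bm{x},\bm{u}) + \bm{y}^\top(h(\bm{x},\bm{u})+\bm{s}) - \bm{v}^\top\bm{x} - \bm{w}^\top\bm{u} - \bm{z}^\top\bm{s},$$ with multipliers $\bm{\lambda}\in\mathbb{R}^{n_x}$, $\bm{y}\in\mathbb{R}^m$, $\bm{v}\in\mathbb{R}^{n_x}$, $\bm{w}\in\mathbb{R}^{n_u}$, $\bm{z}\in\mathbb{R}^m$. All derivatives are evaluated at the current iterate. $\bm{g}_u,\bm{g}_x$ are the gradients of $f$ with respect to $\bm{u},\bm{x}$; $G_u\in\mathbb{R}^{n_x\times n_u}$, $G_x\in\mathbb{R}^{n_x\times n_x}$ are the partial Jacobians of $g$; $A_u\in\mathbb{R}^{m\times n_u}$, $A_x\in\mathbb{R}^{m\times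 n_x}$ are the partial Jacobians of $h$; and $W_{uu},W_{ux},W_{xu}=W_{ux}^\top,W_{xx}$ are the blocks of the (symmetric) Hessian of $L$ with respect to $(\bm{u},\bm{x})$. At an interior-point iterate, $\bm{x},\bm{u},\bm{s}$ have positive entries. $X,U,S$ denote the diagonal matrices with diagonals $\bm{x},\bm{u},\bm{s}$. The diagonal matrices $\Sigma_u,\Sigma_x,\Sigma_s$ are $\Sigma_u=U^{-1}\mathrm{diag}(\bm{w})$, $\Sigma_x=X^{-1}\mathrm{diag}(\bm{v})$, $\Sigma_s=S^{-1}\mathrm{diag}(\bm{z})$. $I$ is the identity matrix of size $m$, and $G_x^{-\top}=(G_x^{-1})^\top$. With barrier parameter $\mu>0$ and $\bm{e}_n$ the all-ones vector of dimension $n$, the vectors $\bm{r}_i$ are $\bm{r}_1=\bm{g}_u+G_u^\top\bm{\lambda}+A_u^\top\bm{y}-\mu U^{-1}\bm{e}_{n_u}$, $\bm{r}_2=\bm{g}_x+G_x^\top\bm{\lambda}+A_x^\top\bm{y}-\mu X^{-1}\bm{e}_{n_x}$, $\bm{r}_3=\bm{y}-\mu S^{-1}\bm{e}_m$, $\bm{r}_4=g(\bm{x},\bm{u})$, $\bm{r}_5=h(\bm{x},\bm{u})+\bm{s}$. *)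

(* Defs.v *)
From HB Require Import structures.
From mathcomp Require Import all_boot all_order all_algebra.
From mathcomp Require Import all_classical all_reals all_analysis.

Set Implicit Arguments.
Unset Strict Implicit.
Unset Printing Implicit Defensive.

Import Order.TTheory GRing.Theory Num.Theory.
Import numFieldNormedType.Exports.

Local Open Scope classical_set_scope.
Local Open Scope ring_scope.

(* On a finite-dimensional [V], continuity of [a |-> 'd F a] (for the operator
   norm) is the same as continuity of [a |-> 'D_v F a] for each fixed [v]. *)
Definition cont_diff (R : realType) (V W : normedModType R) (F : V -> W) : Prop :=
  (forall a, differentiable F a) /\ (forall v, continuous ('D_v F)).

Definition twice_cont_diff (R : realType) (V W : normedModType R)
    (F : V -> W) : Prop :=
  cont_diff F /\ (forall v, cont_diff ('D_v F)).

(* The library's ['J] acts on row vectors and is therefore the transpose of the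
   Jacobian convention used here: entry (i, j) is dF_i / da_j. *)
Definition jac (R : realType) (p q : nat) (F : 'cV[R]_p -> 'cV[R]_q)
    (a : 'cV[R]_p) : 'M[R]_(q, p) :=
  \matrix_(i, j) ('D_(delta_mx j 0) F a) i 0.

Definition grad (R : realType) (p : nat) (F : 'cV[R]_p -> R)
    (a : 'cV[R]_p) : 'cV[R]_p :=
  \col_j 'D_(delta_mx j 0) F a.

Definition dot (R : realType) (p : nat) (a b : 'cV[R]_p) : R :=
  (a^T *m b) 0 0.

Definition cdiag (R : realType) (p : nat) (a : 'cV[R]_p) : 'M[R]_p :=
  diag_mx a^T.

Definition pos_entries (R : realType) (p : nat) (a : 'cV[R]_p) : Prop :=
  forall i, 0 < a i 0.

Definition lagrangian (R : realType) (nx nu m : nat)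
    (f : 'cV[R]_nx * 'cV[R]_nu -> R)
    (g : 'cV[R]_nx * 'cV[R]_nu -> 'cV[R]_nx)
    (h : 'cV[R]_nx * 'cV[R]_nu -> 'cV[R]_m)
    (lam : 'cV[R]_nx) (y : 'cV[R]_m)
    (v : 'cV[R]_nx) (w : 'cV[R]_nu) (z : 'cV[R]_m)
    (x : 'cV[R]_nx) (u : 'cV[R]_nu) (s : 'cV[R]_m) : R :=
  f (x, u) + dot lam (g (x, u)) + dot y (h (x, u) + s)
  - dot v x - dot w u - dot z s.

(* Main.v *)
Require Import Defs.
From HB Require Import structures.
From mathcomp Require Import all_boot all_order all_algebra.
From mathcomp Require Import all_classical all_reals all_analysis.
From mathcomp Require Import ring.
Import Order.TTheory GRing.Theory Num.Theory.
Import numFieldNormedType.Exports.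
Local Open Scope ring_scope.


(** Since the state Jacobian [Gx] is invertible, two block rows of the augmented
system can be solved uniquely: the linearized state equation
[Gu pu + Gx px = - r4] determines [px] from [pu], and the stationarity equation
in the state determines the adjoint direction [pl] from [pu], [px] and [py],
through the invertible matrix [Gx^T].  The augmented system is therefore
equivalent to these two formulas together with its three remaining rows, in
which [px] and [pl] may be replaced by their values.  The slack row contains
neither of them, and the other two become the corresponding rows of the reduced
system: this is the content of [reduced_stationarity] and
[reduced_inequality].

This is linear algebra over a commutative ring: [augmented_system_reduction] is
the equivalence for arbitrary blocks, and the theorem is its instance for the
derivatives at the current iterate. *)

(** The two entrywise rules expose sums and opposites while leaving products of
matrices opaque, so that a linear identity between matrix products becomes a
ring identity in their entries. *)
Lemma addmxE (V : nmodType) (n k : nat) (A B : 'M[V]_(n, k)) i j :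
  (A + B) i j = A i j + B i j.
Proof. by rewrite mxE. Qed.

Lemma oppmxE (V : zmodType) (n k : nat) (A : 'M[V]_(n, k)) i j :
  (- A) i j = - A i j.
Proof. by rewrite mxE. Qed.

Lemma mulmx_unit_eq (R : comUnitRingType) (n k : nat) (A : 'M[R]_n)
    (X B : 'M[R]_(n, k)) :
  A \in unitmx -> A *m X = B <-> X = invmx A *m B.
Proof. by move=> uA; split=> [<-|->]; rewrite ?mulKmx ?mulKVmx. Qed.

(** Substituting the state and adjoint directions into the control row turns
its residual into that of the reduced control row.  This is a formal identity,
in which [T] stands for the inverse of the state Jacobian, [H] for the
regularized state Hessian, and [D] for the diagonal barrier term. *)
Lemma reduced_stationarity (R : comPzRingType) (nx nu m k : nat)
    (Wuu D : 'M[R]_nu) (Wux : 'M[R]_(nu, nx)) (Wxu : 'M[R]_(nx, nu))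
    (H T : 'M[R]_nx) (Gu : 'M[R]_(nx, nu))
    (Au : 'M[R]_(m, nu)) (Ax : 'M[R]_(m, nx))
    (r1 pu : 'M[R]_(nu, k)) (r2 r4 : 'M[R]_(nx, k)) (py : 'M[R]_(m, k)) :
  let px := - (T *m (r4 + Gu *m pu)) in
  let pl := - (T^T *m (r2 + Ax^T *m py + Wxu *m pu + H *m px)) in
  (Wuu + D) *m pu + (Wux *m px + (Gu^T *m pl + Au^T *m py)) + r1 =
  (Wuu - Wux *m T *m Gu - Gu^T *m T^T *m Wxu + Gu^T *m T^T *m H *m T *m Gu + D)
    *m pu + (Au - Ax *m T *m Gu)^T *m py
  + (r1 - Gu^T *m T^T *m r2 - (Wux - Gu^T *m T^T *m H) *m T *m r4).
Proof.
rewrite /= [(Au - _)^T]raddfB /= !trmx_mul.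
rewrite !(mulmxDl, mulmxDr, mulmxN, mulNmx, opprD, opprK, mulmxA).
(* Once the products are expanded, both sides are sums of the same terms. *)
by apply/matrixP=> i j; rewrite !(addmxE, oppmxE); ring.
Qed.

Lemma reduced_inequality (R : comPzRingType) (nx nu m k : nat)
    (T : 'M[R]_nx) (Gu : 'M[R]_(nx, nu))
    (Au : 'M[R]_(m, nu)) (Ax : 'M[R]_(m, nx))
    (pu : 'M[R]_(nu, k)) (r4 : 'M[R]_(nx, k)) (q r5 : 'M[R]_(m, k)) :
  Au *m pu + (Ax *m (- (T *m (r4 + Gu *m pu))) + q) + r5 =
  (Au - Ax *m T *m Gu) *m pu + q + (r5 - Ax *m T *m r4).
Proof.
rewrite !(mulmxDl, mulmxDr, mulmxN, mulNmx, opprD, mulmxA).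
by apply/matrixP=> i j; rewrite !(addmxE, oppmxE); ring.
Qed.

(** The second and fourth block rows are solved for [pl] and [px]; once these
values hold, the residuals of the other rows agree in the two systems, so each
set of rows vanishes exactly when the other does. *)
Lemma augmented_system_reduction (R : comUnitRingType) (nx nu m k : nat)
    (Wuu Su : 'M[R]_nu) (Wux : 'M[R]_(nu, nx)) (Wxu : 'M[R]_(nx, nu))
    (Wxx Sx Gx : 'M[R]_nx) (Ss : 'M[R]_m) (Gu : 'M[R]_(nx, nu))
    (Au : 'M[R]_(m, nu)) (Ax : 'M[R]_(m, nx))
    (r1 pu : 'M[R]_(nu, k)) (r2 r4 px pl : 'M[R]_(nx, k))
    (r3 r5 ps py : 'M[R]_(m, k)) :
  let T := invmx Gx in
  let hWuu := Wuu - Wux *m T *m Gu - Gu^T *m T^T *m Wxu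
              + Gu^T *m T^T *m (Wxx + Sx) *m T *m Gu in
  let hAu := Au - Ax *m T *m Gu in
  let hr1 := r1 - Gu^T *m T^T *m r2
             - (Wux - Gu^T *m T^T *m (Wxx + Sx)) *m T *m r4 in
  let hr3 := r5 - Ax *m T *m r4 in
  let K : 'M[R]_(nu + (nx + (m + (nx + m)))) :=
    col_mx (row_mx (Wuu + Su) (row_mx Wux (row_mx 0 (row_mx Gu^T Au^T))))
   (col_mx (row_mx Wxu (row_mx (Wxx + Sx) (row_mx 0 (row_mx Gx^T Ax^T))))
   (col_mx (row_mx 0 (row_mx 0 (row_mx Ss (row_mx 0 (- 1%:M)))))
   (col_mx (row_mx Gu (row_mx Gx (row_mx 0 (row_mx 0 0))))
           (row_mx Au (row_mx Ax (row_mx (- 1%:M) (row_mx 0 0))))))) in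
  let hK : 'M[R]_(nu + (m + m)) :=
    col_mx (row_mx (hWuu + Su) (row_mx 0 hAu^T))
   (col_mx (row_mx 0 (row_mx Ss (- 1%:M)))
           (row_mx hAu (row_mx (- 1%:M) 0))) in
  Gx \in unitmx ->
  K *m col_mx pu (col_mx px (col_mx ps (col_mx pl py)))
    = - col_mx r1 (col_mx r2 (col_mx r3 (col_mx r4 r5)))
  <->
  [/\ hK *m col_mx pu (col_mx ps py) = - col_mx hr1 (col_mx r3 hr3),
      px = - (T *m (r4 + Gu *m pu))
    & pl = - (T^T *m (r2 + Ax^T *m py + Wxu *m pu + (Wxx + Sx) *m px))].
Proof.
move=> T hWuu hAu hr1 hr3 K hK uGx.
have state_row : Gu *m pu + Gx *m px = - r4
    <-> px = - (T *m (r4 + Gu *m pu)).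
  rewrite -mulmxN -mulmx_unit_eq // opprD.
  by split=> [<-|->]; [rewrite addrAC subrr add0r | rewrite addrC subrK].
have adjoint_row :
    Wxu *m pu + ((Wxx + Sx) *m px + (Gx^T *m pl + Ax^T *m py)) = - r2
    <-> pl = - (T^T *m (r2 + Ax^T *m py + Wxu *m pu + (Wxx + Sx) *m px)).
  rewrite -mulmxN /T trmx_inv -mulmx_unit_eq ?unitmx_tr //.
  split=> [/(congr1 -%R)|->]; last first.
    by apply/matrixP=> i j; rewrite !(addmxE, oppmxE); ring.
  rewrite opprK => <-.
  by apply/matrixP=> i j; rewrite !(addmxE, oppmxE); ring.
(* The residual identities become equalities between the two sets of rows as
   soon as [px] and [pl] are folded back into them. *)
have control_row := @reduced_stationarity R nx nu m k Wuu Su Wux Wxu (Wxx + Sx) T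
  Gu Au Ax r1 pu r2 r4 py.
have inequality_row := @reduced_inequality R nx nu m k T Gu Au Ax pu r4
  (- ps) r5.
rewrite /K /hK !mul_col_mx !mul_row_col !opp_col_mx !mul0mx ?(mulNmx, mul1mx).
rewrite ?(add0r, addr0).
split.
- case/eq_col_mx=> e1 /eq_col_mx[/adjoint_row e2] /eq_col_mx[e3].
  case/eq_col_mx=> /state_row e4 e5.
  rewrite /= -e4 -e2 in control_row; rewrite -e4 in inequality_row.
  split=> //; congr col_mx; last congr col_mx => //.
    by apply/eqP; rewrite -addr_eq0 -control_row e1 addNr.
  by apply/eqP; rewrite -addr_eq0 -inequality_row e5 addNr.
- case=> /eq_col_mx[e1 /eq_col_mx[e3 e5]] e4 e2.
  rewrite /= -e4 -e2 in control_row; rewrite -e4 in inequality_row.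
  congr col_mx; first by apply/eqP; rewrite -addr_eq0 control_row e1 addNr.
  congr col_mx; first exact/adjoint_row.
  congr col_mx => //.
  congr col_mx; first exact/state_row.
  by apply/eqP; rewrite -addr_eq0 inequality_row e5 addNr.
Qed.

Theorem theorem2p1 (R : realType) (nx nu m : nat)
    (f : 'cV[R]_nx * 'cV[R]_nu -> R)
    (g : 'cV[R]_nx * 'cV[R]_nu -> 'cV[R]_nx)
    (h : 'cV[R]_nx * 'cV[R]_nu -> 'cV[R]_m)
    (f_C2 : twice_cont_diff f) (g_C2 : twice_cont_diff g)
    (h_C2 : twice_cont_diff h)
    (x : 'cV[R]_nx) (u : 'cV[R]_nu) (s : 'cV[R]_m)
    (lam : 'cV[R]_nx) (y : 'cV[R]_m)
    (v : 'cV[R]_nx) (w : 'cV[R]_nu) (z : 'cV[R]_m) (mu : R)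
    (x_pos : pos_entries x) (u_pos : pos_entries u) (s_pos : pos_entries s)
    (mu_pos : 0 < mu) :
  let L := fun (x' : 'cV[R]_nx) (u' : 'cV[R]_nu) =>
    lagrangian f g h lam y v w z x' u' s in
  let gu := grad (fun u' => f (x, u')) u in
  let gx := grad (fun x' => f (x', u)) x in
  let Gu := jac (fun u' => g (x, u')) u in
  let Gx := jac (fun x' => g (x', u)) x in
  let Au := jac (fun u' => h (x, u')) u in
  let Ax := jac (fun x' => h (x', u)) x in
  let Wuu := jac (fun u' => grad (fun u'' => L x u'') u') u in
  let Wux := jac (fun x' => grad (fun u' => L x' u') u) x in
  let Wxu := jac (fun u' => grad (fun x' => L x' u') x) u in
  let Wxx := jac (fun x' => grad (fun x'' => L x'' u) x') x in
  let Sigu := invmx (cdiag u) *m cdiag w in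
  let Sigx := invmx (cdiag x) *m cdiag v in
  let Sigs := invmx (cdiag s) *m cdiag z in
  let r1 := gu + Gu^T *m lam + Au^T *m y
            - mu *: (invmx (cdiag u) *m const_mx 1) in
  let r2 := gx + Gx^T *m lam + Ax^T *m y
            - mu *: (invmx (cdiag x) *m const_mx 1) in
  let r3 := y - mu *: (invmx (cdiag s) *m const_mx 1) in
  let r4 := g (x, u) in
  let r5 := h (x, u) + s in
  let iGx := invmx Gx in
  let hWuu := Wuu - Wux *m iGx *m Gu - Gu^T *m iGx^T *m Wxu
              + Gu^T *m iGx^T *m (Wxx + Sigx) *m iGx *m Gu in
  let hAu := Au - Ax *m iGx *m Gu in
  let hr1 := r1 - Gu^T *m iGx^T *m r2
             - (Wux - Gu^T *m iGx^T *m (Wxx + Sigx)) *m iGx *m r4 in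
  let hr2 := r3 in
  let hr3 := r5 - Ax *m iGx *m r4 in
  let K : 'M[R]_(nu + (nx + (m + (nx + m)))) :=
    col_mx (row_mx (Wuu + Sigu) (row_mx Wux          (row_mx 0      (row_mx Gu^T Au^T))))
   (col_mx (row_mx Wxu          (row_mx (Wxx + Sigx) (row_mx 0      (row_mx Gx^T Ax^T))))
   (col_mx (row_mx 0            (row_mx 0            (row_mx Sigs   (row_mx 0    (- 1%:M)))))
   (col_mx (row_mx Gu           (row_mx Gx           (row_mx 0      (row_mx 0    0))))
           (row_mx Au           (row_mx Ax           (row_mx (- 1%:M) (row_mx 0  0))))))) in
  let hK : 'M[R]_(nu + (m + m)) :=
    col_mx (row_mx (hWuu + Sigu) (row_mx 0         hAu^T))
   (col_mx (row_mx 0             (row_mx Sigs      (- 1%:M)))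
           (row_mx hAu           (row_mx (- 1%:M)  0))) in
  Gx \in unitmx ->
  forall (pu : 'cV[R]_nu) (px : 'cV[R]_nx) (ps : 'cV[R]_m)
         (pl : 'cV[R]_nx) (py : 'cV[R]_m),
    K *m col_mx pu (col_mx px (col_mx ps (col_mx pl py)))
      = - col_mx r1 (col_mx r2 (col_mx r3 (col_mx r4 r5)))
    <->
    [/\ hK *m col_mx pu (col_mx ps py) = - col_mx hr1 (col_mx hr2 hr3),
        px = - (iGx *m (r4 + Gu *m pu))
      & pl = - (iGx^T *m (r2 + Ax^T *m py + Wxu *m pu + (Wxx + Sigx) *m px))].
Proof.
by move=> *; apply: augmented_system_reduction.
Qed.
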